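(* Consider the sparse network influence regression model described in the context, and assume Conditions (C1)–(C4) stated there hold. With $\mu$ and $\bm\rho_{(\mathcal S_1)}$ the true parameter values and $$\widetilde Q(\mu,\bm\rho_{(\mathcal S_1)})=\|\mathbb Y_{(\mathcal S_0)}-A_{(\mathcal S_0,\mathcal S_1)}\mathcal D_{(\mathcal S_1)}\mathbb Y_{(\mathcal S_1)}\|^2+(\mathbb Y_{(\mathcal S_1)}-H_1^{-1}\mu\mathbf 1)^\top H_1^\top H_1(\mathbb Y_{(\mathcal S_1)}-H_1^{-1}\mu\mathbf 1)+2\sigma^2\ln|H_1|,$$ $$Q(\bm\rho_{(\mathcal S_1)})=\|\mathbb Y_{(\mathcal S_0)}-A_{(\mathcal S_0,\mathcal S_1)}\mathcal D_{(\mathcal S_1)}\mathbb Y_{(\mathcal S_1)}\|^2,$$ where $H_1=I_{|\mathcal S_1|}-A_{(\mathcal S_1,\mathcal S_1)}\mathcal D_{(\mathcal S_1)}$, $\mathbf 1$ is the all-ones vector of length $|\mathcal S_1|$ and $|H_1|$ is the determinant, we have $$\{\widetilde Q(\mu,\bm\rho_{(\mathcal S_1)})-Q(\bm\rho_{(\mathcal S_1)})\}/Q(\bm\rho_{(\mathcal S_1)})=O_p(N^{\alpha_1-1})\quad\text{as }N\to\infty.$$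
   Context: Model. There are $N$ users with a fixed (nonrandom) adjacency matrix $A=(a_{ij})\in\{0,1\}^{N\times N}$, $a_{ii}=0$, where $a_{ij}=1$ means user $i$ follows user $j$. The responses $\mathbb Y=(Y_1,\dots,Y_N)^\top$ satisfy $Y_i=\mu_i+\sum_{j=1}^N\rho_j a_{ij}Y_j+\varepsilon_i$, $i=1,\dots,N$, where $\varepsilon_1,\dots,\varepsilon_N$ are i.i.d. with mean $0$ and variance $\sigma^2$, $\bm\rho=(\rho_1,\dots,\rho_N)^\top$, and $\mu_i=\mu$ if $\rho_i\neq0$, $\mu_i=0$ if $\rho_i=0$. Let $\mathcal S_1=\{j:\rho_j\ne0\}$, $\mathcal S_0=\{1,\dots,N\}\setminus\mathcal S_1$, $\mathcal N_i=\{j:a_{ji}\ne0\}$ ($|\mathcal N_i|$ is the in-degree). All quantities may depend on $N$. Notation. For a vector $v$, $v_{(\mathcal S)}=(v_i:i\in\mathcal S)$; for a matrix $M$, $M_{(\mathcal S_a,\mathcal S_b)}$ is the submatrix with rows in $\mathcal S_a$ and columns in $\mathcal S_b$; $\mathcal D_{(\mathcal S)}=\mathrm{diag}(\rho_j:j\in\mathcal S)$. $\lambda_{\min},\lambda_{\max}$ denote extreme eigenvalues, $\|\cdot\|_F$ the Frobenius norm. Conditions. (C1) There are finite positive constants $c_0,C_1$ with $E\{\exp(c_0\varepsilon_i^2)\}<C_1$ (sub-Gaussian errors). (C2) With $\Sigma=\mathrm{cov}(\mathbb Y)$, there are constants $0<\lambda_a<\lambda_b<\infty$ with $\lambda_a<\lambda_{\min}(\Sigma)\le\lambda_{\max}(\Sigma)<\lambda_b$.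 (C3) (i) $|\mathcal S_1|=O(N^{\alpha_1})$ for some $\alpha_1<1$; (ii) $\min_{i\in\mathcal S_1}|\mathcal N_i|\ge N/C_2$ for a finite constant $C_2>0$. (C4) $\|N^{-1}A_{(\mathcal S_0,\mathcal S_1)}^\top A_{(\mathcal S_0,\mathcal S_1)}-\Lambda_1\|_F=o(1)$ for a positive definite $\Lambda_1$ with $0<\tau_{\min,1}<\lambda_{\min}(\Lambda_1)\le\lambda_{\max}(\Lambda_1)<\tau_{\max,1}<\infty$. *)

(* Defs.v *)
From HB Require Import structures.
From mathcomp Require Import all_boot all_order all_algebra.
From mathcomp Require Import all_classical all_reals all_analysis.
Set Implicit Arguments. Unset Strict Implicit. Unset Printing Implicit Defensive.
Import Order.TTheory GRing.Theory Num.Theory.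
Import numFieldNormedType.Exports.
Local Open Scope classical_set_scope.
Local Open Scope ring_scope.

Section Defs.
Variable R : realType.

Definition mutually_independent d (T : measurableType d) (P : probability T R)
    (n : nat) (X : 'I_n -> T -> R) : Prop :=
  forall B : 'I_n -> set R, (forall i, measurable (B i)) ->
    P (\big[setI/setT]_(i < n) (X i @^-1` B i)) =
    (\prod_(i < n) P (X i @^-1` B i))%E.

Definition bigOp (d : nat -> measure_display) (T : forall N, measurableType (d N))
    (P : forall N, probability (T N) R) (X : forall N, T N -> R) (a : nat -> R) :
    Prop :=
  forall e : R, 0 < e -> exists M : R, 0 < M /\ exists N0 : nat,
    forall N : nat, (N0 <= N)%N ->
      (P N [set x | (M * a N < `| X N x |)%R] < e%:E)%E.

Definition frobenius (m n : nat) (M : 'M[R]_(m, n)) : R :=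
  Num.sqrt (\sum_(i < m) \sum_(j < n) M i j ^+ 2).

Definition S1 (N : nat) (rho : 'I_N -> R) : {set 'I_N} := [set j | rho j != 0].
Definition S0 (N : nat) (rho : 'I_N -> R) : {set 'I_N} := ~: S1 rho.

Definition ev1 (N : nat) (rho : 'I_N -> R) (a : 'I_#|S1 rho|) : 'I_N :=
  enum_val a.
Definition ev0 (N : nat) (rho : 'I_N -> R) (a : 'I_#|S0 rho|) : 'I_N :=
  enum_val a.

Definition Ysub1 N (rho : 'I_N -> R) (Y : 'I_N -> R) : 'cV[R]_#|S1 rho| :=
  \col_a Y (ev1 a).
Definition Ysub0 N (rho : 'I_N -> R) (Y : 'I_N -> R) : 'cV[R]_#|S0 rho| :=
  \col_b Y (ev0 b).
Definition A01 N (A : 'M[R]_N) (rho : 'I_N -> R) : 'M[R]_(#|S0 rho|, #|S1 rho|) :=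
  \matrix_(b, a) A (ev0 b) (ev1 a).
Definition A11 N (A : 'M[R]_N) (rho : 'I_N -> R) : 'M[R]_#|S1 rho| :=
  \matrix_(a, c) A (ev1 a) (ev1 c).
Definition D1 N (rho : 'I_N -> R) : 'M[R]_#|S1 rho| :=
  diag_mx (\row_a rho (ev1 a)).
Definition H1 N (A : 'M[R]_N) (rho : 'I_N -> R) : 'M[R]_#|S1 rho| :=
  1%:M - A11 A rho *m D1 rho.

Definition Qfun N (A : 'M[R]_N) (rho : 'I_N -> R) (Y : 'I_N -> R) : R :=
  let r := Ysub0 rho Y - A01 A rho *m D1 rho *m Ysub1 rho Y in
  \sum_b r b ord0 ^+ 2.

Definition Qtilde N (A : 'M[R]_N) (rho : 'I_N -> R) (mu sigma : R)
    (Y : 'I_N -> R) : R :=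
  let H := H1 A rho in
  let v := Ysub1 rho Y - invmx H *m (mu *: const_mx 1) in
  Qfun A rho Y + (v^T *m H^T *m H *m v) ord0 ord0
  + 2 * sigma ^+ 2 * ln `| \det H |.

End Defs.

(* Main.v *)
(** Let [H = I - A diag(rho)], so that [H Y = m + eps]. The rows of the model in [S0] say that
    [Q] is the sum of [eps_i ^ 2] over [S0], and those in [S1] that [Qtilde - Q] is the sum of
    [eps_i ^ 2] over [S1] plus [2 sigma^2 ln |det H1|]. The covariance of [Y] is
    [sigma^2 H^-1 H^-T], and its [S1] block satisfies [H1 Sigma11 H1^T = sigma^2 I]. By (C2) and
    the spectral theorem, [det Sigma11] lies between [la^k] and [lb^k] with [k = #|S1|]; hence
    [ln |det H1| = O(k)], since [sigma^2] is bounded above by (C1) and is at least [la]: a row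
    of [H] indexed by [S0] sends [Y] to a noise variable up to a constant and has norm at least 1.
    The sum over [S1] is bounded by Markov's inequality, and the sum over [S0] from below by
    Chebyshev's, with the moments given by (C1). *)

Require Import Defs.
From HB Require Import structures.
From mathcomp Require Import all_boot all_order all_algebra.
From mathcomp Require Import all_classical all_reals all_analysis.
From mathcomp Require Import measurable_realfun ring lra complex spectral sesquilinear.
Import Order.TTheory GRing.Theory Num.Theory.
Import numFieldNormedType.Exports.
Local Open Scope classical_set_scope.
Local Open Scope ring_scope.

Set Implicit Arguments.
Unset Strict Implicit.
Unset Printing Implicit Defensive.

(** * Symmetric matrices *)

Section SymmetricSpectral.
Local Open Scope sesquilinear_scope.

(** Over [R[i]] a real symmetric matrix is hermitian, hence normal, so it is unitarily
    diagonalizable with a real spectrum. Only [U] stays complex; the diagonal descends to [R], so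
    later bounds can be stated with real eigenvalues. *)
Lemma symmetric_spectral (R : rcfType) n (M : 'M[R]_n) : M^T = M ->
  exists (U : 'M[R[i]]_n) (D : 'rV[R]_n),
    [/\ U *m U^t* = 1%:M, U^t* *m U = 1%:M,
        map_mx (real_complex R) M = U^t* *m diag_mx (map_mx (real_complex R) D) *m U
      & forall i, eigenvalue M (D 0 i)].
Proof.
move=> symM; set Mc := map_mx (real_complex R) M.
have McH : Mc \is hermsymmx.
  apply: realsym_hermsym.
    apply/is_hermitianmxP; rewrite expr0 scale1r map_mx_id //.
    by rewrite /Mc map_trmx symM.
  by apply/mxOverP => i j; rewrite mxE complex_real.
have /orthomx_spectralP := hermitian_normalmx McH.
have /mxOverP Dreal := hermitian_spectral_diag_real McH.
have := spectral_unitarymx Mc.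
move: (spectralmx Mc) (spectral_diag Mc) Dreal => U D Dreal Uunit.
rewrite invmx_unitary// => McE.
have UU : U *m U^t* = 1%:M by apply/unitarymxP.
have UU' : U^t* *m U = 1%:M.
  by rewrite -invmx_unitary// mulVmx// unitarymx_unit.
pose Dr : 'rV[R]_n := map_mx (@complex.Re R) D.
have DrE : map_mx (real_complex R) Dr = D.
  apply/rowP => j; rewrite !mxE.
  exact/RRe_real/Dreal.
exists U, Dr; rewrite DrE; split => // i.
(* Eigenvalues are roots of the characteristic polynomial, so the claim can be checked over [R[i]],
   where row [i] of [U] is an eigenvector. *)
rewrite eigenvalue_root_char -(fmorph_root (real_complex R)).
rewrite map_char_poly -/Mc -eigenvalue_root_char.
apply/eigenvalueP; exists (delta_mx 0 i *m U).
  rewrite McE !mulmxA -[_ *m U *m _]mulmxA UU mulmx1.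
  rewrite -[delta_mx 0 i *m diag_mx D](_ : D 0 i *: delta_mx 0 i = _).
    by rewrite -scalemxAl; congr (_ *: _); rewrite -DrE mxE.
  apply/rowP => j; rewrite mul_mx_diag !mxE /=.
  by have [->|] := eqVneq j i; rewrite ?mulr1 ?mul1r ?mulr0 ?mul0r.
apply/eqP => /(congr1 (fun v => v *m U^t*)); rewrite -mulmxA UU mulmx1 mul0mx.
by move/rowP/(_ i); rewrite !mxE !eqxx => /eqP; rewrite oner_eq0.
Qed.

Section Rayleigh.
Variables (R : rcfType) (n : nat) (M : 'M[R]_n) (a b : R).
Hypothesis symM : M^T = M.
Hypothesis specM : forall l, eigenvalue M l -> a <= l <= b.

(** In the coordinates [w = u U^*] both quadratic forms become sums of [|w_i|^2], with weights [D_i]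
    and 1 respectively, and the comparison is termwise. *)
Lemma rayleigh_bounds (u : 'rV[R]_n) :
  a * (u *m u^T) 0 0 <= (u *m M *m u^T) 0 0 <= b * (u *m u^T) 0 0.
Proof.
have [U [D [_ UU ME eigD]]] := symmetric_spectral symM.
have [w wE] : exists w : 'rV[R[i]]_n, w = map_mx (real_complex R) u *m U^t* by eexists.
(* Used twice: [E = D] yields the form of [M], and [E] constant 1 yields the squared norm. *)
have wq (E : 'rV[R]_n) : (real_complex R) (\sum_i E 0 i * complex.Re (`|w 0 i| ^+ 2)) =
   (w *m diag_mx (map_mx (real_complex R) E) *m w^t*) 0 0.
  rewrite rmorph_sum mxE; apply: eq_bigr => i _.
  rewrite mul_mx_diag !mxE -!mulrA [in RHS]mulrCA.
  rewrite -normCK rmorphM; congr (_ * _).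
  have wreal : `|w 0 i| ^+ 2 \is Num.real by rewrite rpredX// normr_real.
  by rewrite -[RHS](RRe_real wreal).
have wt : w^t* = U *m map_mx (real_complex R) u^T.
  rewrite wE trmx_mul map_mxM trmxCK; congr (_ *m _).
  by apply/matrixP => i j; rewrite !mxE; exact: conjc_real.
have q1 : (u *m M *m u^T) 0 0 = \sum_i D 0 i * complex.Re (`|w 0 i| ^+ 2).
  apply: complexI; rewrite wq wt.
  have -> (x : 'M[R]_1) : real_complex R (x 0 0) = map_mx (real_complex R) x 0 0 by rewrite mxE.
  by rewrite !map_mxM ME wE !mulmxA.
have q0 : (u *m u^T) 0 0 = \sum_i complex.Re (`|w 0 i| ^+ 2).
  transitivity (\sum_i (const_mx 1 : 'rV[R]_n) 0 i * complex.Re (`|w 0 i| ^+ 2)); last first.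
    by apply: eq_bigr => i _; rewrite mxE mul1r.
  apply: complexI; rewrite wq wt.
  have -> (x : 'M[R]_1) : real_complex R (x 0 0) = map_mx (real_complex R) x 0 0 by rewrite mxE.
  have -> : map_mx (real_complex R) (const_mx 1 : 'rV[R]_n) = const_mx 1.
    by apply/rowP => i; rewrite !mxE.
  rewrite diag_const_mx mulmx1 wE !mulmxA -[_ *m U^t* *m U]mulmxA UU mulmx1.
  by rewrite map_mxM.
have wge0 i : 0 <= complex.Re (`|w 0 i| ^+ 2).
  have : 0 <= `|w 0 i| ^+ 2 by rewrite exprn_ge0.
  by case: (`|w 0 i| ^+ 2) => x y; rewrite lecE /= => /andP[].
rewrite q0 q1 !mulr_sumr; apply/andP; split; apply: ler_sum => i _;
  by have /andP[? ?] := specM (eigD i); rewrite ler_wpM2r.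
Qed.

Lemma det_spectral_bounds : 0 <= a -> a ^+ n <= \det M <= b ^+ n.
Proof.
move=> a0; have [U [D [UU _ ME eigD]]] := symmetric_spectral symM.
have -> : \det M = \prod_i D 0 i.
  apply: (fmorph_inj (real_complex R)); rewrite rmorph_prod -det_map_mx ME.
  rewrite !det_mulmx mulrAC -det_mulmx (mulmx1C UU) det1 mul1r det_diag.
  by apply: eq_bigr => i _; rewrite mxE.
have p c : c ^+ n = \prod_(i < n) c by rewrite prodr_const card_ord.
rewrite !p; apply/andP; split; apply: ler_prod => i _;
  have /andP[aD Db] := specM (eigD i); rewrite ?a0 ?aD//.
by rewrite Db (le_trans a0).
Qed.

End Rayleigh.

End SymmetricSpectral.

Lemma row_sqr (R : pzRingType) n (u : 'rV[R]_n) : (u *m u^T) 0 0 = \sum_i u 0 i ^+ 2.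
Proof. by rewrite mxE; apply: eq_bigr => i _; rewrite mxE expr2. Qed.

Lemma row_sqr_gt0 (R : realDomainType) n (u : 'rV[R]_n) : u != 0 -> 0 < (u *m u^T) 0 0.
Proof.
move=> u0; rewrite row_sqr lt0r sumr_ge0 ?andbT; last by move=> *; exact: sqr_ge0.
apply: contraNN u0 => /eqP/psumr_eq0P H; apply/eqP/rowP => i; rewrite mxE.
by apply/eqP; rewrite -sqrf_eq0 H// => *; exact: sqr_ge0.
Qed.

(** An eigenvector [v] of the compression gives the test vector [v S] for [M]; it has the norm of
    [v] because the rows of [S] are orthonormal, and its Rayleigh quotient is [l]. *)
Lemma compression_eigenvalue_bounds (R : rcfType) k n (S : 'M[R]_(k, n)) (M : 'M[R]_n) (a b : R) :
    M^T = M -> S *m S^T = 1%:M ->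
    (forall l, eigenvalue M l -> a <= l <= b) ->
  forall l, eigenvalue (S *m M *m S^T) l -> a <= l <= b.
Proof.
move=> symM SS specM l /eigenvalueP[v vE v0].
have := rayleigh_bounds symM specM (v *m S).
rewrite trmx_mul !mulmxA -[v *m S *m S^T]mulmxA SS mulmx1.
have -> : v *m S *m M *m S^T *m v^T = l *: (v *m v^T).
  by rewrite scalemxAl -vE !mulmxA.
have -> : (l *: (v *m v^T)) 0 0 = l * (v *m v^T) 0 0 by rewrite mxE.
by rewrite !ler_pM2r ?row_sqr_gt0.
Qed.

(** * Independence and moments *)

Section Independence.
Local Open Scope ereal_scope.
Variables (R : realType) (d : measure_display) (T : measurableType d) (P : probability T R).

(** The law of the pair [(X, Y)] agrees with the product of the marginals on rectangles, hence
    everywhere by uniqueness of the product measure; Fubini then splits the integral of [x y]. *)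
Lemma Lfun1_expectationM_indep (X Y : {RV P >-> R}) :
    (forall A B : set R, measurable A -> measurable B ->
       P ((X @^-1` A) `&` (Y @^-1` B)) = P (X @^-1` A) * P (Y @^-1` B)) ->
    (X : T -> R) \in Lfun P 2%:E -> (Y : T -> R) \in Lfun P 2%:E ->
  'E_P[(X : T -> R) * Y] = 'E_P[X] * 'E_P[Y].
Proof.
move=> ind X2 Y2.
have Pfin : P setT \is a fin_num := fin_num_measure P _ measurableT.
have /Lfun1_integrable iX := Lfun_subset12 Pfin X2.
have /Lfun1_integrable iY := Lfun_subset12 Pfin Y2.
have /Lfun1_integrable iXY := Lfun2_mul_Lfun1 X2 Y2.
have mXY : measurable_fun [set: T] (fun t => (X t, Y t)).
  exact: measurable_fun_pair.
pose XY : {mfun T >-> (R * R)%type} := HB.pack (fun t => (X t, Y t))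
  (@isMeasurableFun.Build _ _ _ _ _ mXY).
pose f (z : R * R) : \bar R := (z.1 * z.2)%:E.
have mf : measurable_fun [set: R * R] f.
  apply/measurable_EFinP; apply: measurable_funM;
    [exact: measurable_fst|exact: measurable_snd].
have prodE (A : set (R * R)) : measurable A ->
    (distribution P X \x distribution P Y) A = distribution P XY A.
  apply: (@product_measure_unique _ _ _ _ _ _ _ (distribution P XY)) => C D mC mD.
  exact: ind.
(* Integrability, required by Fubini, is inherited from the joint law, for which it is that of
   [X * Y]. *)
have iff : (distribution P X \x distribution P Y).-integrable setT f.
  have : (distribution P XY).-integrable setT f.
    exact: (integrable_pushforward mXY mf iXY measurableT).
  move=> /integrableP[_ fi]; apply/integrableP; split => //.
  rewrite (eq_measure_integral (distribution P XY))// => A mA _.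
  exact: prodE.
transitivity (\int[distribution P XY]_z f z).
  rewrite (integral_pushforward mXY mf _ measurableT)//; first by rewrite unlock.
rewrite (eq_measure_integral (distribution P X \x distribution P Y)); last first.
  by move=> A mA _; exact/esym/prodE.
rewrite -integral12_prod_meas1//.
have iY' : (distribution P Y).-integrable setT EFin.
  by apply: integrable_pushforward => //; exact/measurable_EFinP.
have iX' : (distribution P X).-integrable setT EFin.
  by apply: integrable_pushforward => //; exact/measurable_EFinP.
have EY : \int[distribution P Y]_y y%:E = 'E_P[Y].
  by rewrite integral_distribution// ?unlock//; exact/measurable_EFinP.
have EX : \int[distribution P X]_y y%:E = 'E_P[X].
  by rewrite integral_distribution// ?unlock//; exact/measurable_EFinP.
rewrite /fubini_F /f/=.
under eq_integral => x _.
  under eq_integral => y _ do rewrite EFinM.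
  rewrite integralZl// EY.
  rewrite -[X in _ * X]fineK ?expectation_fin_num ?Lfun_subset12//.
  over.
rewrite integralZr// EX fineK// expectation_fin_num// Lfun_subset12//.
Qed.

Lemma sqr_integrable_Lfun2 (f : T -> R) : measurable_fun [set: T] f ->
  \int[P]_x (f x ^+ 2)%:E < +oo -> f \in Lfun P 2%:E.
Proof.
move=> mf foo; rewrite inE; apply/andP; split; rewrite inE//=.
rewrite /finite_norm unlock /= poweR_lty//; apply: le_lt_trans foo.
rewrite le_eqVlt; apply/orP; left; apply/eqP; apply: eq_integral => x _.
by rewrite /= powR_mulrn// real_normK// num_real.
Qed.

Lemma covariance_sum_l (I : Type) (r : seq I) (a : I -> R) (Z : I -> T -> R) (W : T -> R) :
    (forall i, Z i \in Lfun P 2%:E) -> W \in Lfun P 2%:E ->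
  covariance P (fun x => \sum_(i <- r) a i * Z i x)%R W =
  \sum_(i <- r) (a i)%:E * covariance P (Z i) W.
Proof.
move=> Z2 W2; have Pfin : P setT \is a fin_num := fin_num_measure P _ measurableT.
have le12 : (1 <= 2 :> R)%R by rewrite ler1n.
elim: r => [|i r IH].
  rewrite big_nil -(covariance_cst_l P 0 W); congr covariance.
  by apply/funext => x; rewrite big_nil.
have ZW1 := Lfun2_mul_Lfun1 (Z2 i) W2.
rewrite big_cons -IH -covarianceZl ?(Lfun_subset12 Pfin (Z2 i)) ?(Lfun_subset12 Pfin W2)//.
rewrite -covarianceDl//; last 2 first.
- exact: Lfun_scale.
- have -> : (fun x => \sum_(i <- r) a i * Z i x)%R = (\sum_(i <- r) (a i \o* Z i))%R.
    by apply/funext => x; rewrite fct_sumE; apply: eq_bigr => j _; rewrite mulrC.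
  by rewrite rpred_sum ?lee1n// => j _; exact: Lfun_scale.
by congr covariance; apply/funext => x; rewrite big_cons /= mulrC.
Qed.

Lemma lincomb_Lfun2 (I : Type) (r : seq I) (a : I -> R) (Z : I -> T -> R) (c : R) :
    (forall i, Z i \in Lfun P 2%:E) ->
  (fun x => c + \sum_(i <- r) a i * Z i x)%R \in Lfun P 2%:E.
Proof.
move=> Z2; have le12 : (1 <= 2 :> R)%R by rewrite ler1n.
have -> : (fun x => c + \sum_(i <- r) a i * Z i x)%R =
    (cst c + \sum_(i <- r) (a i \o* Z i))%R.
  apply/funext => x; rewrite !fctE fct_sumE; congr (_ + _)%R.
  by apply: eq_bigr => j _; rewrite mulrC.
rewrite rpredD ?lee1n//; first exact: Lfun_cst.
by rewrite rpred_sum ?lee1n// => j _; exact: Lfun_scale.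
Qed.

Lemma covariance_shift_l (c : R) (X W : T -> R) :
    X \in Lfun P 2%:E -> W \in Lfun P 2%:E ->
  covariance P (fun x => c + X x)%R W = covariance P X W.
Proof.
move=> X2 W2; rewrite [LHS](covarianceDl (X := cst c))//; last exact: Lfun_cst.
by rewrite covariance_cst_l add0e.
Qed.

(** Bilinearity leaves only the diagonal terms. It serves for the noise (invertibility of the
    influence matrix, covariance of [Y]) and for the squared noise (variance of a sum of
    squares). *)
Lemma covariance_lincomb n (Z : 'I_n -> T -> R) (s a b : 'I_n -> R) (c c' : R) :
    (forall i, Z i \in Lfun P 2%:E) ->
    (forall i j, covariance P (Z i) (Z j) = (if i == j then s i else 0)%:E) ->
  covariance P (fun x => c + \sum_i a i * Z i x)%R (fun x => c' + \sum_i b i * Z i x)%R =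
  (\sum_i s i * a i * b i)%:E.
Proof.
move=> Z2 covZ.
have lc2 (e : 'I_n -> R) : (fun x => \sum_i e i * Z i x)%R \in Lfun P 2%:E.
  rewrite [X in X \in _](_ : _ = fun x => 0 + \sum_i e i * Z i x)%R; first exact: lincomb_Lfun2.
  by apply/funext => x; rewrite add0r.
rewrite covariance_shift_l ?lincomb_Lfun2//.
rewrite covarianceC covariance_shift_l// covarianceC covariance_sum_l//.
rewrite -sumEFin; apply: eq_bigr => i _.
rewrite covarianceC covariance_sum_l// (bigD1 i)//= big1 ?adde0.
  by rewrite covZ eqxx -!EFinM; congr EFin; rewrite mulrA mulrC mulrA.
by move=> j ji; rewrite covZ (negbTE ji) mule0.
Qed.

Lemma expectation_sumM (I : Type) (r : seq I) (a : I -> R) (Z : I -> T -> R) :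
    (forall i, Z i \in Lfun P 1) ->
  'E_P[fun x => (\sum_(i <- r) a i * Z i x)%R] = \sum_(i <- r) (a i)%:E * 'E_P[Z i].
Proof.
move=> Z1; elim: r => [|i r IH].
  rewrite big_nil; transitivity ('E_P[cst 0%R]); last by rewrite expectation_cst.
  congr expectation; by apply/funext => x; rewrite big_nil.
rewrite big_cons -IH -expectationZl// -expectationD//.
- by congr expectation; apply/funext => x; rewrite big_cons /= mulrC.
- exact: Lfun_scale.
- have -> : (fun x => \sum_(i <- r) a i * Z i x)%R = (\sum_(i <- r) (a i \o* Z i))%R.
    by apply/funext => x; rewrite fct_sumE; apply: eq_bigr => j _; rewrite mulrC.
  by rewrite rpred_sum ?lee1n// => j _; exact: Lfun_scale.
Qed.

(** With [t = c X^2 >= 0], the bounds [t <= exp t] and [t^2 / 2 <= exp t] turn the exponential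
    moment into bounds on the second and fourth moments. The fourth moment dominates the variance of
    [X^2]. *)
Lemma subgaussian_moments (X : {RV P >-> R}) (c C : R) : (0 < c)%R ->
    'E_P[fun x => expR (c * X x ^+ 2)%R] < C%:E ->
  [/\ (X : T -> R) \in Lfun P 2%:E, ((X : T -> R) ^+ 2)%R \in Lfun P 2%:E,
      'E_P[(X : T -> R) ^+ 2] <= (C / c)%:E
    & 'V_P[((X : T -> R) ^+ 2)%R] <= (2 * C / c ^+ 2)%:E].
Proof.
move=> c0 expC.
have mX : measurable_fun [set: T] X by [].
have mX2 : measurable_fun [set: T] (fun x => X x ^+ 2)%R.
  exact: measurable_funX.
have mX4 : measurable_fun [set: T] (fun x => (X x ^+ 2) ^+ 2)%R.
  exact: (measurable_funX 2 mX2).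
have me : measurable_fun [set: T] (fun x => expR (c * X x ^+ 2)%R).
  by apply: measurableT_comp => //; exact: measurable_funM.
(* Applied with [k = c] to [X^2] and with [k = c^2 / 2] to [X^4]. *)
have bnd (f : T -> R) k : (0 < k)%R -> measurable_fun [set: T] f -> (forall x, 0 <= f x)%R ->
    (forall x, k * f x <= expR (c * X x ^+ 2))%R -> \int[P]_x (f x)%:E <= (C / k)%:E.
  move=> k0 mf f0 fe; rewrite EFinM lee_pdivlMr//.
  have -> : \int[P]_x (f x)%:E * k%:E = \int[P]_x (k * f x)%:E.
    rewrite -ge0_integralZr//; first by apply: eq_integral => x _; rewrite -EFinM mulrC.
    - exact/measurable_EFinP.
    - by move=> x _; rewrite lee_fin.
    - by rewrite lee_fin ltW.
  apply/ltW; apply: le_lt_trans expC; rewrite unlock ge0_le_integral//.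
  - by move=> x _; rewrite lee_fin mulr_ge0// ltW.
  - by apply/measurable_EFinP; exact: measurable_funM.
  - exact/measurable_EFinP.
  - by move=> x _; rewrite lee_fin.
have e2 : \int[P]_x (X x ^+ 2)%:E <= (C / c)%:E.
  apply: bnd => // x; first exact: sqr_ge0.
  by rewrite (le_trans _ (expR_ge1Dx _))// lerDr.
have e4 : \int[P]_x ((X x ^+ 2) ^+ 2)%:E <= (2 * C / c ^+ 2)%:E.
  have -> : (2 * C / c ^+ 2 = C / (c ^+ 2 / 2))%R.
    by rewrite invf_div mulrCA mulrA mulrC.
  apply: bnd => // [|x|x]; first by rewrite divr_gt0// exprn_gt0.
    exact: sqr_ge0.
  have cX : (0 <= c * X x ^+ 2)%R by rewrite mulr_ge0 ?sqr_ge0// ltW.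
  have := expR_ge1Dxn 1 cX; apply: le_trans.
  have -> : ((c * X x ^+ 2) ^+ 2 / 2`!%:R = c ^+ 2 / 2 * X x ^+ 2 ^+ 2)%R by rewrite exprMn mulrAC.
  by rewrite lerDr.
have X2 : (X : T -> R) \in Lfun P 2%:E.
  by apply: sqr_integrable_Lfun2 => //; rewrite (le_lt_trans e2)// ltry.
have XX2 : ((X : T -> R) ^+ 2)%R \in Lfun P 2%:E.
  by apply: sqr_integrable_Lfun2 => //; rewrite (le_lt_trans e4)// ltry.
split => //; first by rewrite unlock.
rewrite varianceE//; apply: le_trans e4.
have -> : 'E_P[((X : T -> R) ^+ 2) ^+ 2] = \int[P]_x ((X x ^+ 2) ^+ 2)%:E by rewrite unlock.
by rewrite geeDl// oppe_le0 sqre_ge0.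
Qed.

End Independence.

(** * Tail bounds for sums of squares *)

Section Tails.
Local Open Scope ereal_scope.
Variables (R : realType) (d : measure_display) (T : measurableType d) (P : probability T R).

Lemma mutually_independent_pair n (X : 'I_n -> T -> R) (i j : 'I_n) (A B : set R) :
    mutually_independent P X -> i != j -> measurable A -> measurable B ->
  P ((X i @^-1` A) `&` (X j @^-1` B)) = P (X i @^-1` A) * P (X j @^-1` B).
Proof.
move=> ind ij mA mB.
(* The whole line at every other index contributes a factor 1, which reduces the full product
   formula to a pair. *)
pose C k := if k == i then A else if k == j then B else setT.
have mC k : measurable (C k) by rewrite /C; case: ifP => // _; case: ifP.
have Ci : C i = A by rewrite /C eqxx.
have Cj : C j = B by rewrite /C eqxx eq_sym (negbTE ij).
have Ck k : k != i -> k != j -> C k = setT by rewrite /C => /negbTE-> /negbTE->.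
have := ind _ mC.
rewrite (bigD1 i)//= (bigD1 j) ?(eq_sym j)//= [X in _ `&` (_ `&` X)]big1; last first.
  by move=> k /andP[ki kj]; rewrite Ck// preimage_setT.
rewrite (bigD1 i)//= (bigD1 j) ?(eq_sym j)//= [X in _ * (_ * X)]big1; last first.
  by move=> k /andP[ki kj]; rewrite Ck// preimage_setT probability_setT.
by rewrite setIT mule1 Ci Cj.
Qed.

(** Stated with a transformation [g] because it is needed both for the noise ([g] the identity) and
    for its squares. *)
Lemma mutually_independent_covariance n (X : 'I_n -> {RV P >-> R}) (g : R -> R) (i j : 'I_n) :
    mutually_independent P (fun k => X k : T -> R) -> i != j -> measurable_fun [set: R] g ->
    (g \o X i) \in Lfun P 2%:E -> (g \o X j) \in Lfun P 2%:E ->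
  covariance P (g \o X i) (g \o X j) = 0.
Proof.
move=> ind ij mg gi gj; have Pfin : P setT \is a fin_num := fin_num_measure P _ measurableT.
have gi1 := Lfun_subset12 Pfin gi; have gj1 := Lfun_subset12 Pfin gj.
have gij1 := Lfun2_mul_Lfun1 gi gj.
rewrite covarianceE//.
have mgX k : measurable_fun [set: T] (g \o X k) by exact: measurableT_comp.
pose Y k : {RV P >-> R} := HB.pack (g \o X k) (@isMeasurableFun.Build _ _ _ _ _ (mgX k)).
rewrite (@Lfun1_expectationM_indep _ _ _ P (Y i) (Y j))//.
  by rewrite subee// fin_numM// expectation_fin_num.
move=> A B mA mB.
have mgA : measurable (g @^-1` A) by rewrite -[_ @^-1` _]setTI; exact: mg.
have mgB : measurable (g @^-1` B) by rewrite -[_ @^-1` _]setTI; exact: mg.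
exact: (mutually_independent_pair ind ij mgA mgB).
Qed.

Lemma markov_nonneg (f : T -> R) (K : R) : (0 < K)%R -> measurable_fun [set: T] f ->
  (forall x, 0 <= f x)%R -> P [set x | K <= f x]%R <= (K^-1)%:E * 'E_P[f].
Proof.
move=> K0 mf f0; pose X : {RV P >-> R} := HB.pack f (@isMeasurableFun.Build _ _ _ _ _ mf).
rewrite muleC lee_pdivlMr// muleC.
have := @markov _ _ _ P X idfun _ K0; rewrite /=.
have -> : [set x | K%:E <= `|(f x)%:E|] = [set x | (K <= f x)%R].
  by apply/seteqP; split => x /=; rewrite lee_fin ger0_norm.
have -> : (idfun \o (fun x : R => `|x|)%R \o X : T -> R) = f by apply/funext => x /=; rewrite ger0_norm.
by apply => //; exact: measurable_id.
Qed.

Lemma chebyshev_lower (f : T -> R) (m K : R) : (0 < K)%R -> measurable_fun [set: T] f ->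
  'E_P[f] = m%:E -> P [set x | f x <= m - K]%R <= (K ^- 2)%:E * 'V_P[f].
Proof.
move=> K0 mf fm; pose X : {RV P >-> R} := HB.pack f (@isMeasurableFun.Build _ _ _ _ _ mf).
apply: le_trans (@chebyshev _ _ _ P X _ K0).
apply: le_measure; rewrite ?inE.
- by rewrite -[X in measurable X]setTI; apply: measurable_fun_le.
- rewrite -[X in measurable X]setTI; apply: measurable_fun_le => //.
  by apply: measurableT_comp => //; apply: measurable_funB.
- move=> x /=; rewrite fm /= => fx; rewrite ler0_norm; first by rewrite opprB lerBrDl -lerBrDr.
  by rewrite subr_le0 (le_trans fx)// gerBl ltW.
Qed.

(** With 0/1 weights, a sum over a subset becomes a linear combination over all indices, the form
    required by [expectation_sumM] and [covariance_lincomb]. *)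
Lemma sum_sqr_setE n (X : 'I_n -> T -> R) (S : {set 'I_n}) :
  (fun x => \sum_(i in S) X i x ^+ 2)%R = (fun x => \sum_i (i \in S)%:R * (X i ^+ 2) x)%R.
Proof.
apply/funext => x; rewrite big_mkcond; apply: eq_bigr => i _.
by case: (i \in S); rewrite ?mul1r ?mul0r.
Qed.

Lemma measurable_sum_sqr n (X : 'I_n -> {RV P >-> R}) (S : {set 'I_n}) :
  measurable_fun [set: T] (fun x => \sum_(i in S) X i x ^+ 2)%R.
Proof.
rewrite sum_sqr_setE; apply: measurable_sum => i; exact: measurable_funM.
Qed.

Lemma markov_sum_sqr n (X : 'I_n -> {RV P >-> R}) (S : {set 'I_n}) (B K : R) : (0 < K)%R ->
    (forall i, (X i : T -> R) \in Lfun P 2%:E) ->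
    (forall i, 'E_P[(X i : T -> R) ^+ 2] <= B%:E) ->
  P [set x | K <= \sum_(i in S) X i x ^+ 2]%R <= (#|S|%:R * B / K)%:E.
Proof.
move=> K0 X2 XB.
apply: (le_trans (markov_nonneg K0 _ _)).
- exact: measurable_sum_sqr.
- by move=> x; apply: sumr_ge0 => *; exact: sqr_ge0.
rewrite mulrC EFinM lee_pmul2l// ?lte_fin ?invr_gt0//.
rewrite sum_sqr_setE expectation_sumM; last by move=> i; exact: Lfun2_mul_Lfun1.
rewrite -sum1_card natr_sum mulr_suml [in leRHS]big_mkcond -sumEFin.
apply: lee_sum => i _; case: (i \in S); rewrite ?mul1e ?mul0e ?mul1r//.
Qed.

(** The threshold is half the mean [|S| s], so the deviation is [|S| s / 2]. The squares are
    uncorrelated, so the variance is at most [|S| V], and the quotient decays like [1 / |S|]. *)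
Lemma chebyshev_sum_sqr n (X : 'I_n -> {RV P >-> R}) (S : {set 'I_n}) (s V : R) :
    (0 < s)%R -> (0 < #|S|)%N ->
    mutually_independent P (fun k => X k : T -> R) ->
    (forall i, (X i : T -> R) \in Lfun P 2%:E) ->
    (forall i, ((X i : T -> R) ^+ 2)%R \in Lfun P 2%:E) ->
    (forall i, 'E_P[(X i : T -> R) ^+ 2] = s%:E) ->
    (forall i, 'V_P[((X i : T -> R) ^+ 2)%R] <= V%:E) ->
  P [set x | \sum_(i in S) X i x ^+ 2 <= #|S|%:R * s / 2]%R <=
  (4 * V / (s ^+ 2 * #|S|%:R))%:E.
Proof.
move=> s0 S0 ind X2 XX2 Xs XV.
have Pfin : P setT \is a fin_num := fin_num_measure P _ measurableT.
have sumE := sum_sqr_setE (fun k => X k : T -> R) S.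
have S0' : (0 < #|S|%:R :> R)%R by rewrite ltr0n.
have K0 : (0 < #|S|%:R * s / 2)%R by rewrite divr_gt0// mulr_gt0.
have Ef : 'E_P[fun x => \sum_(i in S) X i x ^+ 2]%R = (#|S|%:R * s)%:E.
  rewrite sumE expectation_sumM; last by move=> i; exact: Lfun2_mul_Lfun1.
  rewrite -sum1_card natr_sum mulr_suml [in RHS]big_mkcond -sumEFin.
  by apply: eq_bigr => i _; case: (i \in S); rewrite ?mul1e ?mul0e ?mul1r.
have mf : measurable_fun [set: T] (fun x => \sum_(i in S) X i x ^+ 2)%R.
  exact: measurable_sum_sqr.
have := chebyshev_lower K0 mf Ef.
have -> : (#|S|%:R * s - #|S|%:R * s / 2 = #|S|%:R * s / 2)%R.
  by rewrite {1}[(#|S|%:R * s)%R]splitr addrK.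
move=> /le_trans; apply.
have -> : 'V_P[(fun x => \sum_(i in S) X i x ^+ 2)%R] =
    (\sum_i fine 'V_P[((X i : T -> R) ^+ 2)%R] * (i \in S)%:R * (i \in S)%:R)%:E.
  rewrite sumE /variance -(@covariance_lincomb _ _ _ P n _ _ _ _ 0 0 XX2).
    by congr covariance; apply/funext => x; rewrite add0r.
  move=> i j; case: eqVneq => [<-|ij]; first by rewrite fineK// variance_fin_num.
  have mg : measurable_fun [set: R] (fun r : R => r ^+ 2)%R.
    by apply: measurable_funX; exact: measurable_id.
  exact: (mutually_independent_covariance ind ij mg (XX2 i) (XX2 j)).
rewrite -EFinM lee_fin.
have -> : (4 * V / (s ^+ 2 * #|S|%:R) = (#|S|%:R * s / 2) ^- 2 * (#|S|%:R * V))%R.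
  by field; rewrite !gt_eqF.
rewrite ler_pM2l ?invr_gt0 ?exprn_gt0//.
rewrite -sum1_card natr_sum mulr_suml [in leRHS]big_mkcond ler_sum// => i _.
case: (i \in S); rewrite ?mulr0 ?mulr1 ?mul1r//.
by rewrite -lee_fin fineK ?variance_fin_num.
Qed.

End Tails.

(** * The influence model *)

Section Selection.
Variables (R : realType) (N : nat) (A : 'M[R]_N) (rho : 'I_N -> R).

(** This is [I - A diag(rho)] on all users; its columns outside [S1] are those of the identity. *)
Definition influence_mx : 'M[R]_N := \matrix_(i, j) ((i == j)%:R - rho j * A i j).

(** Left multiplication keeps the rows in [S1], so the [S1] block of a matrix [M] is [S M S^T]. *)
Definition S1_selector : 'M[R]_(#|S1 rho|, N) := \matrix_(a, i) (i == ev1 a)%:R.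

Lemma rho_outside_S1 i : i \notin S1 rho -> rho i = 0.
Proof. by rewrite inE negbK => /eqP. Qed.

Lemma rho_ev1 (a : 'I_#|S1 rho|) : rho (ev1 a) != 0.
Proof. by have := enum_valP a; rewrite inE. Qed.

Lemma rho_ev0 (b : 'I_#|S0 rho|) : rho (ev0 b) = 0.
Proof. by have := enum_valP b; rewrite 2!inE negbK => /eqP. Qed.

Lemma S1_selector_orthonormal : S1_selector *m S1_selector^T = 1%:M.
Proof.
apply/matrixP => a c; rewrite !mxE (bigD1 (ev1 a))//= big1 ?addr0; last first.
  by move=> i /negbTE ia; rewrite !mxE ia mul0r.
by rewrite !mxE eqxx mul1r /ev1 (inj_eq enum_val_inj).
Qed.

(** Block triangularity: on the rows in [S1], the columns outside [S1] vanish because [rho] does,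
    and the remaining block is [H1]. This relation carries invertibility and determinants from the
    full matrix to [H1]. *)
Lemma S1_selector_influence : S1_selector *m influence_mx = H1 A rho *m S1_selector.
Proof.
apply/matrixP => a i; rewrite !mxE (bigD1 (ev1 a))//= big1 ?addr0; last first.
  by move=> k /negbTE ka; rewrite !mxE ka mul0r.
rewrite !mxE eqxx mul1r.
have [iS|iS] := boolP (i \in S1 rho); last first.
  rewrite big1; last first.
    move=> c _; rewrite [S1_selector _ _]mxE.
    have /negbTE -> : i != ev1 c by apply: contraNneq iS => ->; exact: enum_valP.
    by rewrite mulr0.
  rewrite (rho_outside_S1 iS) mul0r subr0.
  by have /negbTE -> : ev1 a != i by apply: contraNneq iS => <-; exact: enum_valP.
pose c := enum_rank_in iS i; have ic : i = ev1 c by rewrite /ev1 enum_rankK_in.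
rewrite (bigD1 c)//= big1 ?addr0; last first.
  move=> c' c'c; rewrite [S1_selector _ _]mxE ic.
  have /negbTE -> : ev1 c != ev1 c' by rewrite /ev1 (inj_eq enum_val_inj) eq_sym.
  by rewrite mulr0.
rewrite /H1 mul_mx_diag !mxE ic eqxx mulr1 [rho _ * _]mulrC.
by rewrite /ev1 (inj_eq enum_val_inj).
Qed.

End Selection.

(** * Residuals of the model in terms of the noise *)

Section Model.
Variables (R : realType) (N : nat) (A : 'M[R]_N) (rho : 'I_N -> R) (mu : R).
Variables (y e : 'I_N -> R).
Hypothesis model : forall i, y i = (if rho i != 0 then mu else 0)
                + \sum_(j < N) rho j * A i j * y j + e i.

Lemma influence_mxE :
  influence_mx A rho *m (\col_i y i) = \col_i ((if rho i != 0 then mu else 0) + e i).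
Proof.
apply/colP => i; rewrite !mxE.
transitivity (y i - \sum_j rho j * A i j * y j); last by rewrite model addrAC addrK.
under eq_bigr => j _ do rewrite !mxE mulrBl.
rewrite sumrB (bigD1 i)//= eqxx mul1r big1 ?addr0// => j /negbTE ji.
by rewrite eq_sym ji mul0r.
Qed.

Lemma sum_S1 (i : 'I_N) :
  \sum_(a < #|S1 rho|) A i (ev1 a) * rho (ev1 a) * y (ev1 a) = \sum_j rho j * A i j * y j.
Proof.
rewrite -(big_enum_val (fun j => A i j * rho j * y j)) [in LHS]big_mkcond.
apply: eq_bigr => j _; case: ifPn => [_|/rho_outside_S1->]; last by rewrite !mul0r.
by rewrite [A i j * _]mulrC.
Qed.

Lemma QfunE : Qfun A rho y = \sum_(i in S0 rho) e i ^+ 2.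
Proof.
rewrite big_enum_val; apply: eq_bigr => b _; congr (_ ^+ 2).
rewrite mul_mx_diag !mxE.
under eq_bigr => a _ do rewrite !mxE.
by rewrite (sum_S1 (ev0 b)) model rho_ev0 eqxx add0r addrAC subrr add0r.
Qed.

Lemma H1_Ysub1 : H1 A rho *m Ysub1 rho y = mu *: const_mx 1 + \col_a e (ev1 a).
Proof.
apply/colP => a; rewrite mulmxBl mul1mx mul_mx_diag !mxE.
under eq_bigr => c _ do rewrite !mxE.
rewrite (sum_S1 (ev1 a)) [in y (ev1 a)]model rho_ev1 mulr1.
by rewrite addrAC addrK.
Qed.

Lemma QtildeE (sigma : R) : H1 A rho \in unitmx ->
  Qtilde A rho mu sigma y - Qfun A rho y =
  \sum_(i in S1 rho) e i ^+ 2 + 2 * sigma ^+ 2 * ln `|\det (H1 A rho)|.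
Proof.
move=> unitH; rewrite /Qtilde -(addrA (Qfun _ _ _)) [LHS]addrAC subrr add0r; congr (_ + _).
(* The quadratic form is [|H1 v|^2], and [H1] sends the centred responses to the noise on [S1]. *)
set v := _ - _; have Hv : H1 A rho *m v = \col_a e (ev1 a).
  by rewrite mulmxBr mulmxA mulmxV// mul1mx H1_Ysub1 addrAC subrr add0r.
rewrite -!mulmxA mulmxA -trmx_mul Hv mxE [in RHS]big_enum_val.
by apply: eq_bigr => a _; rewrite !mxE expr2.
Qed.

End Model.

(** * Covariance of the responses and the determinant of [H1] *)

Section Covariance.
Variables (R : realType) (d : measure_display) (T : measurableType d) (P : probability T R).
Variables (N : nat) (A : 'M[R]_N) (rho : 'I_N -> R) (mu s2 : R).
Variables (eps : 'I_N -> {RV P >-> R}) (Y : T -> 'I_N -> R).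
Hypothesis s2_gt0 : 0 < s2.
Hypothesis eps2 : forall i, (eps i : T -> R) \in Lfun P 2%:E.
Hypothesis cov_eps : forall i j,
  (covariance P (eps i) (eps j) = (if i == j then s2 else 0)%:E)%E.
Hypothesis model : forall x i, Y x i = (if rho i != 0 then mu else 0)
  + \sum_(j < N) rho j * A i j * Y x j + eps i x.

Local Notation H := (influence_mx A rho).
Let m i : R := if rho i != 0 then mu else 0.
Local Notation Sigma := (\matrix_(i, j) fine (covariance P
                      (fun x => Y x i) (fun x => Y x j))).

(* A left null vector [u] of [H] would make [u . eps] constant, although its variance is [s2 |u|^2]. *)
Lemma influence_unit : H \in unitmx.
Proof.
rewrite -row_free_unit -kermx_eq0; apply/rowV0P => u /sub_kermxP uH.
apply/eqP/negPn/negP => u0.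
have := @covariance_lincomb _ _ _ P N _ _ (u 0) (u 0)
  (\sum_i u 0 i * m i) (\sum_i u 0 i * m i) eps2 cov_eps.
have -> : (fun x => \sum_i u 0 i * m i + \sum_i u 0 i * eps i x) = cst 0.
  apply/funext => x; rewrite -big_split /=.
  under eq_bigr => i _ do rewrite -mulrDr.
  have := congr1 (fun M : 'M[R]_(1, 1) => M 0 0) (congr1 (mulmx u) (influence_mxE (model x))).
  rewrite mulmxA uH mul0mx !mxE => E; apply: etrans (esym E); apply: eq_bigr => i _.
  by rewrite mxE.
rewrite covariance_cst_l => /(congr1 fine)/= /esym.
under eq_bigr => i _ do rewrite -mulrA -expr2.
rewrite -mulr_sumr -row_sqr => /eqP; rewrite mulf_eq0 (gt_eqF s2_gt0) /=.
by rewrite (gt_eqF (row_sqr_gt0 u0)).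
Qed.

Lemma covariance_mxE : Sigma = s2 *: (invmx H *m (invmx H)^T).
Proof.
pose G := invmx H.
have YE i : (fun x => Y x i) = (fun x => \sum_k G i k * m k + \sum_k G i k * eps k x).
  apply/funext => x; rewrite -big_split /=.
  under eq_bigr => k _ do rewrite -mulrDr.
  transitivity ((G *m (H *m \col_k Y x k)) i 0).
    by rewrite mulmxA mulVmx ?influence_unit// mul1mx mxE.
  by rewrite (influence_mxE (model x)) mxE; apply: eq_bigr => k _; rewrite mxE.
apply/matrixP => i j; rewrite mxE !YE.
rewrite (@covariance_lincomb _ _ _ P N _ _ _ _ _ _ eps2 cov_eps) /= !mxE mulr_sumr.
by apply: eq_bigr => k _; rewrite mxE mulrA.
Qed.

Lemma covariance_mx_sym : Sigma^T = Sigma.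
Proof. by rewrite covariance_mxE linearZ /= trmx_mul trmxK. Qed.

(** The [S1] block of the inverse of the full influence matrix is a right inverse of [H1], by
    [S1_selector_influence]. *)
Lemma H1_unit : H1 A rho \in unitmx.
Proof.
suff : H1 A rho *m (S1_selector rho *m invmx H *m (S1_selector rho)^T) = 1%:M.
  by move=> /mulmx1_unit[].
rewrite !mulmxA -S1_selector_influence -[_ *m H *m _]mulmxA mulmxV ?influence_unit//.
by rewrite mulmx1 S1_selector_orthonormal.
Qed.

Local Notation Sigma11 := (S1_selector rho *m Sigma *m (S1_selector rho)^T).

(** Moving [H1] across the selector cancels both inverse factors of the covariance, leaving
    [s2 S S^T = s2 I]; determinants are then taken. *)
Lemma det_H1_covariance : \det (H1 A rho) ^+ 2 * \det Sigma11 = s2 ^+ #|S1 rho|.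
Proof.
have : H1 A rho *m Sigma11 *m (H1 A rho)^T = s2%:M.
  rewrite covariance_mxE !mulmxA -S1_selector_influence.
  rewrite -!scalemxAr -!scalemxAl -[_ *m H *m _ *m _]mulmxA.
  rewrite -!mulmxA -trmx_mul -S1_selector_influence trmx_mul.
  rewrite [(invmx H)^T *m (_ *m _)]mulmxA -[(invmx H)^T *m _]trmx_mul.
  rewrite [H *m (_ *m _)]mulmxA mulmxV ?influence_unit// trmx1 !mul1mx.
  by rewrite S1_selector_orthonormal scalemx1.
move=> /(congr1 determinant); rewrite !det_mulmx det_tr det_scalar => <-.
by rewrite expr2 mulrAC.
Qed.

Variables (la lb : R).
Hypotheses (la_gt0 : 0 < la) (la_lt_lb : la < lb).
Hypothesis specS : forall l, eigenvalue Sigma l -> la < l /\ l < lb.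

Let specS' l : eigenvalue Sigma l -> la <= l <= lb.
Proof. by move=> /specS[? ?]; rewrite !ltW. Qed.

(** The test vector is row [j] of the influence matrix with [j] in [S0]. The inverse sends it to the
    [j]-th unit row, so its quadratic form is [s2]; its squared norm is at least 1 since [rho j = 0]
    makes the diagonal entry 1. *)
Lemma noise_variance_ge : (0 < #|S0 rho|)%N -> la <= s2.
Proof.
move=> /card_gt0P[j]; rewrite inE => /rho_outside_S1 rj.
have /andP[+ _] := rayleigh_bounds covariance_mx_sym specS' (row j H).
rewrite covariance_mxE -scalemxAr -scalemxAl.
have -> : row j H *m (invmx H *m (invmx H)^T) *m (row j H)^T = 1%:M.
  have rowH : row j H *m invmx H = row j 1%:M by rewrite -row_mul mulmxV ?influence_unit.
  rewrite !mulmxA rowH -mulmxA -trmx_mul rowH; apply/matrixP => a b; rewrite !ord1 mxE.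
  rewrite (bigD1 j)//= !mxE !eqxx mul1r big1 ?addr0// => k kj.
  by rewrite !mxE [j == k]eq_sym (negbTE kj) mul0r.
rewrite row_sqr; have -> : (s2 *: 1%:M : 'M[R]_1) 0 0 = s2 by rewrite !mxE mulr1.
apply: le_trans; rewrite ler_pMr// (bigD1 j)//= !mxE eqxx rj mul0r subr0 expr1n.
by rewrite lerDl sumr_ge0// => k _; exact: sqr_ge0.
Qed.

Lemma ln_det_H1_bound (B : R) : la <= s2 -> s2 <= B ->
  `|2 * ln `|\det (H1 A rho)| | <=
  #|S1 rho|%:R * (2 * `|ln la| + `|ln lb| + `|ln B|).
Proof.
move=> las2 s2B; have detH : \det (H1 A rho) != 0 by rewrite -unitfE -unitmxE H1_unit.
have symS : Sigma11^T = Sigma11.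
  by rewrite !trmx_mul trmxK covariance_mx_sym mulmxA.
have specS1 := compression_eigenvalue_bounds covariance_mx_sym
  (S1_selector_orthonormal rho) specS'.
have /andP[] := det_spectral_bounds symS specS1 (ltW la_gt0).
have := det_H1_covariance; move: (\det Sigma11) => D detE laD Dlb.
have D0 : 0 < D by apply: lt_le_trans laD; rewrite exprn_gt0.
(* Logarithm of [det_H1_covariance]. Both terms on the right are of order [#|S1 rho|], since
   [la <= s2 <= B] and [D] lies between powers of [la] and [lb]. *)
have -> : 2 * ln `|\det (H1 A rho)| = #|S1 rho|%:R * ln s2 - ln D.
  rewrite [_%:R * ln s2]mulr_natl -lnXn// -detE lnM ?posrE// ?exprn_even_gt0//.
  by rewrite addrK mulr_natl -lnXn ?normr_gt0// real_normK// num_real.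
have B0 : 0 < B by rewrite (lt_le_trans s2_gt0).
have lb0 : 0 < lb := lt_trans la_gt0 la_lt_lb.
have Dla : #|S1 rho|%:R * ln la <= ln D.
  by rewrite mulr_natl -lnXn// ler_ln ?posrE ?exprn_gt0.
have Dlb' : ln D <= #|S1 rho|%:R * ln lb.
  by rewrite mulr_natl -lnXn// ler_ln ?posrE ?exprn_gt0.
have ls : #|S1 rho|%:R * ln la <= #|S1 rho|%:R * ln s2.
  by rewrite ler_wpM2l// ler_ln ?posrE.
have sB : #|S1 rho|%:R * ln s2 <= #|S1 rho|%:R * ln B.
  by rewrite ler_wpM2l// ler_ln ?posrE.
have abs (t : R) : - (#|S1 rho|%:R * `|t|) <= #|S1 rho|%:R * t <= #|S1 rho|%:R * `|t|.
  by rewrite -ler_norml normrM normr_nat.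
have := abs (ln la); have := abs (ln lb); have := abs (ln B).
move=> /andP[? ?] /andP[? ?] /andP[? ?].
rewrite ler_norml !mulrDr; apply/andP; split; lra.
Qed.

End Covariance.

(** The estimate at fixed [N], with [a] standing for [N^alpha1]. The two terms of the bound are the
    probabilities of two bad events: too much noise energy on [S1] (Markov) and too little on [S0]
    (Chebyshev). *)
Lemma relative_difference_tail (R : realType) (d : measure_display) (T : measurableType d)
  (P : probability T R) (N : nat) (A : 'M[R]_N) (rho : 'I_N -> R) (mu sigma : R)
  (eps : 'I_N -> {RV P >-> R}) (Y : T -> 'I_N -> R) (c C la lb K3 K a : R) :
  (0 < N)%N -> 0 < sigma ->
  mutually_independent P (fun i => (eps i : T -> R)) ->
  (forall i, 'E_P[eps i] = 0)%E ->
  (forall i, 'V_P[eps i] = (sigma ^+ 2)%:E) ->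
  (forall x i, Y x i = (if rho i != 0 then mu else 0)
                + \sum_(j < N) rho j * A i j * Y x j + eps i x) ->
  0 < c -> 0 < C ->
  (forall i, 'E_P[fun x => expR (c * (eps i x) ^+ 2)] < C%:E)%E ->
  0 < la -> la < lb ->
  (forall l, eigenvalue (\matrix_(i, j) fine (covariance P
     (fun x => Y x i) (fun x => Y x j))) l -> la < l /\ l < lb) ->
  0 < K -> 0 < K3 -> 0 < a -> #|S1 rho|%:R <= K3 * a -> K3 * a <= N%:R / 2 ->
  (P [set x | (4 * (K + C / c * (2 * `|ln la| + `|ln lb| + `|ln (C / c)|) * K3) / la
        * (a / N%:R) <
      `|(Qtilde A rho mu sigma (Y x) - Qfun A rho (Y x)) / Qfun A rho (Y x)|)%R]
   <= (K3 * (C / c) / K + 8 * (2 * C / c ^+ 2) / (la ^+ 2 * N%:R))%:E)%E.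
Proof.
move=> N0 sg0 ind mean var model c0 C0 subG la0 lalb spec K0 K30 a0 kK3 K3N.
set L := 2 * _ + _ + _; set B := C / c; set V := 2 * C / c ^+ 2.
have s20 : 0 < sigma ^+ 2 by rewrite exprn_gt0.
have B0 : 0 < B by rewrite divr_gt0.
have V0 : 0 < V by rewrite divr_gt0 ?exprn_gt0// mulr_gt0.
have L0 : 0 <= L by rewrite !addr_ge0// mulr_ge0.
have NR0 : 0 < N%:R :> R by rewrite ltr0n.
have mom i := subgaussian_moments c0 (subG i).
have eps2 i : (eps i : T -> R) \in Lfun P 2%:E by have [] := mom i.
have epsX2 i : ((eps i : T -> R) ^+ 2) \in Lfun P 2%:E by have [] := mom i.
have Eeps2 i : ('E_P[(eps i : T -> R) ^+ 2] = (sigma ^+ 2)%:E)%E.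
  by rewrite -(var i) varianceE// mean expe2 mule0 sube0.
have EB i : ('E_P[(eps i : T -> R) ^+ 2] <= B%:E)%E by have [] := mom i.
have VB i : ('V_P[((eps i : T -> R) ^+ 2)%R] <= V%:E)%E by have [] := mom i.
have cov_eps i j :
    (covariance P (eps i) (eps j) = (if i == j then sigma ^+ 2 else 0)%:E)%E.
  case: eqVneq => [<-|ij]; first exact: var.
  exact: (mutually_independent_covariance ind ij (@measurable_id _ _ setT) (eps2 i) (eps2 j)).
have s2B : sigma ^+ 2 <= B by rewrite -lee_fin -(Eeps2 (Ordinal N0)) EB.
have cardS : (#|S1 rho| + #|S0 rho|)%N = N by rewrite cardsC card_ord.
(* At most [K3 a <= N / 2] indices lie in [S1]. *)
have S0N : N%:R / 2 <= #|S0 rho|%:R :> R.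
  have := congr1 (fun n => n%:R : R) cardS; rewrite natrD; lra.
have S00 : (0 < #|S0 rho|)%N by rewrite -(ltr0n R) (lt_le_trans _ S0N)// divr_gt0.
have S0R0 : 0 < #|S0 rho|%:R :> R by rewrite ltr0n.
have las2 := noise_variance_ge s20 eps2 cov_eps model la0 spec S00.
have ldet := ln_det_H1_bound s20 eps2 cov_eps model la0 lalb spec las2 s2B.
have unitH := H1_unit s20 eps2 cov_eps model.
pose X1 x := \sum_(i in S1 rho) eps i x ^+ 2.
pose X0 x := \sum_(i in S0 rho) eps i x ^+ 2.
pose c1 := 2 * sigma ^+ 2 * ln `|\det (H1 A rho)|.
pose M := 4 * (K + B * L * K3) / la.
have -> : [set x | M * (a / N%:R) <
      `|(Qtilde A rho mu sigma (Y x) - Qfun A rho (Y x)) / Qfun A rho (Y x)|] =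
    [set x | M * (a / N%:R) < `|(X1 x + c1) / X0 x| ].
  by apply/seteqP; split => x /=; rewrite (QtildeE (model x))// (QfunE (model x)).
have M0 : 0 < M.
  rewrite divr_gt0// mulr_gt0// ltr_wpDr//.
  by rewrite mulr_ge0 ?(ltW K30)// mulr_ge0 ?(ltW B0).
have mX1 : measurable_fun [set: T] X1 by exact: measurable_sum_sqr.
have mX0 : measurable_fun [set: T] X0 by exact: measurable_sum_sqr.
have mE1 : measurable [set x | K * a <= X1 x].
  by rewrite -[X in measurable X]setTI; apply: measurable_fun_le.
have mE0 : measurable [set x | X0 x <= #|S0 rho|%:R * sigma ^+ 2 / 2].
  by rewrite -[X in measurable X]setTI; apply: measurable_fun_le.
have c1B : `|c1| <= B * L * K3 * a.
  have -> : c1 = sigma ^+ 2 * (2 * ln `|\det (H1 A rho)|) by rewrite /c1 mulrA [_ ^+ 2 * 2]mulrC.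
  have -> : B * L * K3 * a = B * (L * (K3 * a)) by rewrite !mulrA.
  rewrite normrM (ger0_norm (ltW s20)).
  apply: (ler_pM (ltW s20) _ s2B) => //.
  by apply: (le_trans ldet); rewrite mulrC ler_wpM2l.
have incl : [set x | M * (a / N%:R) < `|(X1 x + c1) / X0 x| ] `<=`
    [set x | K * a <= X1 x] `|` [set x | X0 x <= #|S0 rho|%:R * sigma ^+ 2 / 2].
  move=> x /= Mx; apply/orP; apply: contraTT Mx.
  rewrite negb_or -!ltNge => /andP[X1K X0s]; rewrite -leNgt.
  have X1_ge0 : 0 <= X1 x by apply: sumr_ge0 => *; exact: sqr_ge0.
  (* Half of the mean [#|S0| sigma^2], where [#|S0| >= N / 2] and [sigma^2 >= la]. *)
  have X0_lb : la * N%:R / 4 <= X0 x.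
    apply: le_trans (ltW X0s).
    have : la * (N%:R / 2) <= sigma ^+ 2 * #|S0 rho|%:R.
      by apply: ler_pM; rewrite ?(ltW la0) ?divr_ge0 ?(ltW NR0).
    lra.
  have X0_gt0 : 0 < X0 x by apply: lt_le_trans X0_lb; rewrite divr_gt0// mulr_gt0.
  rewrite normrM normfV (ger0_norm (ltW X0_gt0)) ler_pdivrMr//.
  have num : `|X1 x + c1| <= (K + B * L * K3) * a.
    rewrite (le_trans (ler_normD _ _))// mulrDl lerD// ger0_norm// ltW//.
  apply: (le_trans num).
  have -> : (K + B * L * K3) * a = M * (a / N%:R) * (la * N%:R / 4).
    by rewrite /M; field; rewrite !gt_eqF.
  have num0 : 0 <= (K + B * L * K3) * a := le_trans (normr_ge0 _) num.
  apply: ler_wpM2l => //.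
  have -> : M * (a / N%:R) = (K + B * L * K3) * a * (4 / (la * N%:R)).
    by rewrite /M; field; rewrite !gt_eqF.
  by rewrite mulr_ge0// divr_ge0// mulr_ge0// ltW.
apply: (@le_trans _ _ (P ([set x | K * a <= X1 x] `|`
  [set x | X0 x <= #|S0 rho|%:R * sigma ^+ 2 / 2]))).
  apply: le_measure => //; rewrite inE; last exact: measurableU.
  (* For measurability the division is cleared. Where [X0] vanishes the quotient is 0 by convention,
     so the strict inequality fails and those points belong to neither side. *)
  have -> : [set x | M * (a / N%:R) < `|(X1 x + c1) / X0 x| ] =
      [set x | 0 < `|X0 x|] `&` [set x | M * (a / N%:R) * `|X0 x| < `|X1 x + c1|].
    apply/seteqP; split => x /=; rewrite normrM normfV normr_gt0.
      move=> Mx; have X0x : X0 x != 0.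
        apply: contraTneq Mx => ->; rewrite normr0 invr0 mulr0 -leNgt.
        by rewrite mulr_ge0// ?(ltW M0)// divr_ge0// ltW.
      by split=> //; rewrite -ltr_pdivlMr ?normr_gt0.
    by move=> [X0x Mx]; rewrite ltr_pdivlMr ?normr_gt0.
  have mN (f : T -> R) : measurable_fun [set: T] f -> measurable_fun [set: T] (fun x => `|f x|).
    by move=> mf; exact: measurableT_comp.
  have mlt (f g : T -> R) : measurable_fun [set: T] f -> measurable_fun [set: T] g ->
      measurable [set x | f x < g x].
    move=> mf mg; have -> : [set x | f x < g x] = ~` ([set: T] `&` [set x | g x <= f x]).
      by rewrite setTI; apply/seteqP; split => x /=; rewrite real_ltNge ?num_real// => /negP.
    by apply: measurableC; exact: measurable_fun_le.
  apply: measurableI; apply: mlt => //.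
  - exact: mN.
  - by apply: measurable_funM => //; exact: mN.
  - by apply: mN; exact: measurable_funD.
apply: (le_trans (measureU2 _ _ _)) => //; rewrite EFinD; apply: leeD.
  apply: (le_trans (markov_sum_sqr (S1 rho) (mulr_gt0 K0 a0) eps2 EB)).
  rewrite lee_fin ler_pdivrMr ?mulr_gt0//.
  have -> : K3 * B / K * (K * a) = K3 * a * B by field; rewrite gt_eqF.
  by rewrite ler_pM2r.
apply: (le_trans (chebyshev_sum_sqr s20 S00 ind eps2 epsX2 Eeps2 VB)).
rewrite lee_fin.
have -> : 8 * V / (la ^+ 2 * N%:R) = 4 * V / (la ^+ 2 * (N%:R / 2)).
  by field; rewrite !gt_eqF.
rewrite ler_pM2l; last exact: mulr_gt0.
rewrite lef_pV2 ?posrE ?mulr_gt0 ?divr_gt0 ?exprn_gt0//.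
apply: ler_pM; rewrite ?divr_ge0 ?sqr_ge0 ?(ltW NR0)//.
by rewrite ler_pXn2r// nnegrE ltW.
Qed.

(** * Asymptotics: choice of the constants and of the threshold on [N] *)

Unset Implicit Arguments.

Theorem theoremE1 (R : realType)
  (d : nat -> measure_display) (T : forall N : nat, measurableType (d N))
  (P : forall N : nat, probability (T N) R)
  (A : forall N : nat, 'M[R]_N) (rho : forall N : nat, 'I_N -> R)
  (mu sigma : nat -> R)
  (eps : forall N : nat, 'I_N -> {RV (P N) >-> R})
  (Y : forall N : nat, T N -> 'I_N -> R)
  (alpha1 : R)
  (Lambda1 : forall N : nat, 'M[R]_#|S1 (rho N)|)
  (* adjacency matrix: 0/1 entries, zero diagonal *)
  (hA01 : forall N (i j : 'I_N), A N i j = 0 \/ A N i j = 1)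
  (hAdiag : forall N (i : 'I_N), A N i i = 0)
  (* errors: i.i.d., mean 0, variance sigma^2 *)
  (hsigma : forall N, 0 < sigma N)
  (hind : forall N, mutually_independent (P N) (fun i => (eps N i : T N -> R)))
  (hid : forall N (i j : 'I_N),
      distribution (P N) (eps N i) = distribution (P N) (eps N j))
  (hmean : forall N (i : 'I_N), ('E_(P N)[eps N i] = 0)%E)
  (hvar : forall N (i : 'I_N), 'V_(P N)[eps N i] = (sigma N ^+ 2)%:E)
  (* the model Y_i = mu_i + sum_j rho_j a_ij Y_j + eps_i *)
  (hmodel : forall N (x : T N) (i : 'I_N),
      Y N x i = (if rho N i != 0 then mu N else 0)
                + \sum_(j < N) rho N j * A N i j * Y N x j + eps N i x)
  (* (C1) sub-Gaussian errors *)
  (C1 : exists c0 C1 : R, 0 < c0 /\ 0 < C1 /\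
      forall N (i : 'I_N),
        ('E_(P N)[fun x => expR (c0 * (eps N i x) ^+ 2)] < C1%:E)%E)
  (* (C2) eigenvalues of Sigma = cov(Y) bounded away from 0 and oo *)
  (C2 : exists la lb : R, 0 < la /\ la < lb /\
      forall N (l : R),
        eigenvalue (\matrix_(i, j) fine (covariance (P N)
                      (fun x => Y N x i) (fun x => Y N x j))) l ->
        la < l /\ l < lb)
  (* (C3)(i) |S1| = O(N^alpha1), alpha1 < 1 *)
  (C3i : alpha1 < 1 /\ exists (C : R) (N0 : nat), forall N, (N0 <= N)%N ->
      (#|S1 (rho N)|%:R : R) <= C * (N%:R `^ alpha1))
  (* (C3)(ii) min in-degree over S1 at least N / C2 *)
  (C3ii : exists C2 : R, 0 < C2 /\ forall N (i : 'I_N), i \in S1 (rho N) ->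
      N%:R / C2 <= (#|[pred j : 'I_N | A N j i != 0]|%:R : R))
  (* (C4) *)
  (C4 : (exists tmin tmax : R, 0 < tmin /\ tmin < tmax /\
          forall N, (Lambda1 N)^T = Lambda1 N /\
            forall l : R, eigenvalue (Lambda1 N) l -> tmin < l /\ l < tmax) /\
        (fun N => frobenius (N%:R^-1 *: ((A01 (A N) (rho N))^T *m A01 (A N) (rho N))
                             - Lambda1 N)) @ \oo --> (0 : R)) :
  bigOp P
    (fun N x => (Qtilde (A N) (rho N) (mu N) (sigma N) (Y N x)
                 - Qfun (A N) (rho N) (Y N x)) / Qfun (A N) (rho N) (Y N x))
    (fun N => N%:R `^ (alpha1 - 1)).
Proof.
case: C1 => c [C [c0 [C0 subG]]]; case: C2 => la [lb [la0 [lalb spec]]].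
case: C3i => al1 [C3 [N3 cardS1]] e e0.
(* [K3] is a positive majorant of [C3], whose sign is unknown. *)
pose K3 := `|C3| + 1; pose B := C / c; pose V := 2 * C / c ^+ 2.
(* [K] makes the Markov term [K3 B / K] equal to [e / 4]. *)
pose L := 2 * `|ln la| + `|ln lb| + `|ln B|; pose K := 4 * K3 * B / e.
have K30 : 0 < K3 by rewrite ltr_wpDl.
have B0 : 0 < B by rewrite divr_gt0.
have V0 : 0 < V by rewrite divr_gt0 ?exprn_gt0// mulr_gt0.
have L0 : 0 <= L by rewrite !addr_ge0// mulr_ge0.
have K0 : 0 < K by rewrite divr_gt0// mulr_gt0// mulr_gt0.
exists (4 * (K + B * L * K3) / la); split.
  rewrite divr_gt0// mulr_gt0// ltr_wpDr//.
  by rewrite mulr_ge0 ?(ltW K30)// mulr_ge0 ?(ltW B0).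
(* Beyond [n1], [N^(1 - alpha1) >= 2 K3], that is [K3 N^alpha1 <= N / 2]; beyond [n2], the Chebyshev
   term is at most [e / 4]. *)
pose n1 := Num.bound ((2 * K3) `^ (1 - alpha1)^-1).
pose n2 := Num.bound (32 * V / (la ^+ 2 * e)).
exists (maxn (maxn N3 1) (maxn n1 n2)) => N.
rewrite !geq_max => /andP[/andP[N3N N0] /andP[n1N n2N]].
have NR0 : 0 < N%:R :> R by rewrite ltr0n.
have al0 : 0 < 1 - alpha1 by rewrite subr_gt0.
pose a := N%:R `^ alpha1 : R.
have a0 : 0 < a by rewrite powR_gt0.
have aN : N%:R `^ (1 - alpha1) * a = N%:R.
  by rewrite /a -powRD ?subrK ?powRr1 ?(ltW NR0)// (gt_eqF NR0) implybT.
have aE : N%:R `^ (alpha1 - 1) = a / N%:R.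
  apply: (mulIf (lt0r_neq0 NR0)); rewrite mulfVK ?gt_eqF//.
  by rewrite -{2}[N%:R](@powRr1 R) ?(ltW NR0)// -powRD ?subrK// (gt_eqF NR0) implybT.
have K3N : K3 * a <= N%:R / 2.
  rewrite ler_pdivlMr// -aN -mulrA [a * 2]mulrC mulrA ler_pM2r// mulrC.
  have K32 : 2 * K3 = ((2 * K3) `^ (1 - alpha1)^-1) `^ (1 - alpha1).
    by rewrite -powRrM mulVf ?gt_eqF// powRr1// mulr_ge0// ltW.
  rewrite K32 ge0_ler_powR ?nnegrE ?powR_ge0 ?(ltW al0) ?(ltW NR0)//.
  apply: ltW; apply: (lt_le_trans (archi_boundP (powR_ge0 _ _))).
  by rewrite ler_nat.
have VN : 8 * V / (la ^+ 2 * N%:R) <= e / 4.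
  have d0 : 0 < la ^+ 2 * e by rewrite mulr_gt0// exprn_gt0.
  have : 32 * V / (la ^+ 2 * e) <= N%:R.
    apply: ltW; apply: (lt_le_trans (archi_boundP _)); last by rewrite ler_nat.
    by rewrite divr_ge0 ?(ltW d0)// mulr_ge0// ltW.
  rewrite ler_pdivrMr// => h; rewrite ler_pdivrMr; last by rewrite mulr_gt0// exprn_gt0.
  nra.
have kK3 : #|S1 (rho N)|%:R <= K3 * a.
  apply: (le_trans (cardS1 _ N3N)); rewrite ler_pM2r//.
  by rewrite (le_trans (ler_norm _))// lerDl.
have := relative_difference_tail N0 (hsigma N) (hind N) (hmean N) (hvar N) (hmodel N)
  c0 C0 (subG N) la0 lalb (spec N) K0 K30 a0 kK3 K3N.
rewrite -aE => /le_lt_trans; apply; rewrite lte_fin.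
have -> : K3 * (C / c) / K = e / 4.
  by rewrite /K -/B; field; rewrite !gt_eqF.
(* The total [e / 2] leaves room for the strict inequality in [bigOp]. *)
apply: (@le_lt_trans _ _ (e / 4 + e / 4)); first by rewrite lerD2l.
lra.
Qed.
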